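(* Let $B\subset\mathbb{N}$ with $d(B)=0$ and let $0\le\alpha\le\beta\le 1$ be real numbers. If there exists a set $C\subset\mathbb{N}$ such that $d(C+B)=\beta$, then there exists a set $A\subset\mathbb{N}$ such that $\underline{d}(A+B)=\alpha$ and $\overline{d}(A+B)=\beta$.
   Context: $\mathbb{N}=\{1,2,3,\ldots\}$. For $X,Y\subseteq\mathbb{N}$, $X+Y=\{x+y:x\in X,y\in Y\}$. For $A\subseteq\mathbb{N}$, write $A(n)=\#(A\cap[1,n])$; $\underline{d}(A)=\liminf_{n\to\infty} A(n)/n$, $\overline{d}(A)=\limsup_{n\to\infty}A(n)/n$, and if these are equal their common value is the asymptotic density $d(A)$. *)

(* Defs.v *)
From HB Require Import structures.
From mathcomp Require Import all_boot all_order all_algebra.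
From mathcomp Require Import all_classical all_reals all_analysis.
Set Implicit Arguments.
Unset Strict Implicit.
Unset Printing Implicit Defensive.
Import Order.TTheory GRing.Theory Num.Theory.
Import numFieldNormedType.Exports.

Local Open Scope classical_set_scope.
Local Open Scope ring_scope.

Definition pos_nat : set nat := [set n | (0 < n)%N].

Definition sumset (X Y : set nat) : set nat :=
  [set (x + y)%N | x in X & y in Y].

(* [iota 1 n] lists 1, ..., n. *)
Definition counting_fun (A : set nat) (n : nat) : nat :=
  count (fun k => k \in A) (iota 1 n).

(* The value at n = 0 is 0 / 0 = 0, which does not affect the limits below. *)
Definition density_seq (R : realType) (A : set nat) : R^nat :=
  fun n => (counting_fun A n)%:R / n%:R.

(* [density_seq R A] takes its values in [0, 1], so the [limn]s inside
   [limn_inf] and [limn_sup] exist. *)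
Definition lower_density (R : realType) (A : set nat) : R :=
  limn_inf (density_seq R A).

Definition upper_density (R : realType) (A : set nat) : R :=
  limn_sup (density_seq R A).

Definition has_density (R : realType) (A : set nat) (d : R) : Prop :=
  lower_density R A = d /\ upper_density R A = d.

(* Main.v *)
(** If alpha = beta, take A = C. Otherwise C + B has relative density at least alpha in [1, n]
for all n >= n0, and A is obtained from C by deleting infinitely many finite blocks while keeping
this bound. Since d(B) = 0, deleting one element from a set X changes the density of X + B in
[1, n] only by o(1). Hence a block can be extended until the bound is about to fail, which brings
the density within o(1) of alpha at some large n. After the block, all of C is kept for a long
time: only finitely many elements have been deleted so far, so the density returns close to beta.
Finally, A + B is contained in C + B, so its upper density does not exceed beta. *)

Require Import Defs.
From mathcomp Require Import all_boot all_order all_algebra.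
From mathcomp Require Import all_classical all_reals all_analysis.
From mathcomp Require Import zify lra.
Set Implicit Arguments.
Unset Strict Implicit.
Unset Printing Implicit Defensive.
Import Order.TTheory GRing.Theory Num.Theory.
Import numFieldNormedType.Exports.
Local Open Scope classical_set_scope.
Local Open Scope ring_scope.

(** * Bounds on lower and upper limits of bounded sequences *)

Lemma limn_inf_ge (R : realType) (u : R^nat) (a : R) (N : nat) :
  bounded_fun u -> (forall n, (N <= n)%N -> a <= u n) -> a <= limn_inf u.
Proof.
move=> ub uN; rewrite limn_infE//.
apply: (@le_trans _ _ (infs u N)); last first.
  by apply: ub_le_sup; [exact: bounded_fun_has_ubound_infs|exists N].
apply: lb_le_inf; first by exists (u N), N => /=.
by move=> _ [n /= Nn <-]; exact: uN.
Qed.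

Lemma limn_inf_le (R : realType) (u : R^nat) (a : R) :
  bounded_fun u -> (forall N, exists2 n, (N <= n)%N & u n <= a) ->
  limn_inf u <= a.
Proof.
move=> ub uN; rewrite limn_infE//; apply: ge_sup; first by exists (infs u 0%N), 0%N.
move=> _ [N _ <-]; have [n Nn una] := uN N; apply: le_trans una.
apply: ge_inf; last by exists n.
have [l hl] := bounded_fun_has_lbound ub.
by exists l => _ [k _ <-]; apply: hl; exists k.
Qed.

Lemma limn_sup_le (R : realType) (u : R^nat) (a : R) (N : nat) :
  bounded_fun u -> (forall n, (N <= n)%N -> u n <= a) -> limn_sup u <= a.
Proof.
move=> ub uN; rewrite limn_supE//.
apply: (@le_trans _ _ (sups u N)).
  by apply: ge_inf; [exact: bounded_fun_has_lbound_sups|exists N].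
apply: ge_sup; first by exists (u N), N => /=.
by move=> _ [n /= Nn <-]; exact: uN.
Qed.

Lemma limn_sup_ge (R : realType) (u : R^nat) (a : R) :
  bounded_fun u -> (forall N, exists2 n, (N <= n)%N & a <= u n) ->
  a <= limn_sup u.
Proof.
move=> ub uN; rewrite limn_supE//; apply: lb_le_inf; first by exists (sups u 0%N), 0%N.
move=> _ [N _ <-]; have [n Nn una] := uN N; apply: le_trans una _.
apply: ub_le_sup; last by exists n.
have [l hl] := bounded_fun_has_ubound ub.
by exists l => _ [k _ <-]; apply: hl; exists k.
Qed.

Lemma lt_limn_inf (R : realType) (u : R^nat) (a : R) :
  bounded_fun u -> a < limn_inf u ->
  exists N, forall n, (N <= n)%N -> a < u n.
Proof.
move=> ub au; apply: contrapT => /forallNP H.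
have : limn_inf u <= a; last by rewrite leNgt au.
apply: limn_inf_le => // N.
have /existsNP[n /not_implyP[Nn /negP una]] := H N.
by exists n => //; rewrite leNgt.
Qed.

Lemma limn_sup_lt (R : realType) (u : R^nat) (a : R) :
  bounded_fun u -> limn_sup u < a ->
  exists N, forall n, (N <= n)%N -> u n < a.
Proof.
move=> ub au; apply: contrapT => /forallNP H.
have : a <= limn_sup u; last by rewrite leNgt au.
apply: limn_sup_ge => // N.
have /existsNP[n /not_implyP[Nn /negP una]] := H N.
by exists n => //; rewrite leNgt.
Qed.

(** * Counting elements of unions and translates *)

Lemma counting_fun_le (S T : set nat) (n : nat) :
  (forall k, (k <= n)%N -> S k -> T k) ->
  (counting_fun S n <= counting_fun T n)%N.
Proof.
move=> ST; rewrite /counting_fun -!size_filter; apply: uniq_leq_size.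
  exact/filter_uniq/iota_uniq.
move=> k; rewrite !mem_filter !mem_iota => /andP[/set_mem Sk kn].
by rewrite kn andbT; apply/mem_set/ST => //; lia.
Qed.

Lemma counting_funU (S T : set nat) (n : nat) :
  (counting_fun (S `|` T) n <= counting_fun S n + counting_fun T n)%N.
Proof.
rewrite /counting_fun -count_predUI.
by apply: (leq_trans _ (leq_addr _ _)); apply: sub_count => k /=; rewrite in_setU.
Qed.

(** Subtracting [c] maps the elements of [c + B] in [1, n] injectively into [B]; as [B] consists of
    positive numbers, the images stay in [1, n]. *)
Lemma counting_fun_translate (B : set nat) (c n : nat) : B `<=` pos_nat ->
  (counting_fun (sumset [set c] B) n <= counting_fun B n)%N.
Proof.
move=> hB; rewrite /counting_fun -!size_filter.
rewrite -(size_map (addn c) [seq k <- iota 1 n | k \in B]).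
apply: uniq_leq_size; first exact/filter_uniq/iota_uniq.
move=> k; rewrite mem_filter mem_iota => /andP[/set_mem[_ -> [b Bb <-]] kn].
apply/mapP; exists b => //; rewrite mem_filter mem_iota mem_set//=.
by have := hB _ Bb; rewrite /pos_nat/=; lia.
Qed.

(** * Effect of deletions on the density of a sumset *)

Section density.
Variable R : realType.
Implicit Types B C S T X : set nat.
Local Notation dens := (density_seq R).

Lemma density_seq_ge0 S n : 0 <= dens S n.
Proof. by rewrite divr_ge0. Qed.

Lemma density_seq_bounded S : bounded_fun (dens S).
Proof.
exists 1; split => // x x1 n _ /=; apply: le_trans (ltW x1).
rewrite ger0_norm ?density_seq_ge0// /density_seq.
have [->|n0] := eqVneq n 0%N; first by rewrite invr0 mulr0.
rewrite ler_pdivrMr ?ltr0n ?lt0n// mul1r ler_nat.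
by rewrite /counting_fun (leq_trans (count_size _ _))// size_iota.
Qed.
Local Hint Resolve density_seq_bounded : core.

Lemma density_seq_le S T n :
  (forall k, (k <= n)%N -> S k -> T k) -> dens S n <= dens T n.
Proof. by move=> ST; rewrite ler_wpM2r ?invr_ge0// ler_nat counting_fun_le. Qed.

(** The summands of a number up to [n] are themselves at most [n], so what [C] does beyond [n] is
    invisible in [1, n]. *)
Lemma sumset_le X C B n : (forall k, (k <= n)%N -> C k -> X k) ->
  forall k, (k <= n)%N -> sumset C B k -> sumset X B k.
Proof.
move=> CX k kn [c Cc [b Bb E]]; exists c; last by exists b.
by apply: CX => //; lia.
Qed.

Lemma density_sumset_le X C B n : (forall k, (k <= n)%N -> C k -> X k) ->
  dens (sumset C B) n <= dens (sumset X B) n.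
Proof. by move=> CX; apply/density_seq_le/sumset_le. Qed.

(** Every sum lost with [c] lies in the translate [c + B], which has at most as many elements in
    [1, n] as [B]. *)
Lemma density_sumset_setU1 B X C c n : B `<=` pos_nat ->
  C `<=` X `|` [set c] ->
  dens (sumset C B) n <= dens (sumset X B) n + dens B n.
Proof.
move=> hB CX; rewrite -mulrDl -natrD ler_wpM2r ?invr_ge0// ler_nat.
apply: leq_trans (leq_add (leqnn _) (counting_fun_translate c n hB)).
apply: leq_trans (counting_funU _ _ _); apply: counting_fun_le => k _.
by move=> [x Cx [b Bb <-]]; case: (CX _ Cx) => Xx; [left|right]; exists x => //; exists b.
Qed.

(** Each number below [m] costs at most one translate of [B]; the induction puts them into [X] one
    at a time. *)
Lemma density_sumset_setU_initial B X C m n : B `<=` pos_nat ->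
  C `<=` X `|` [set k | (k < m)%N] ->
  dens (sumset C B) n <= dens (sumset X B) n + m%:R * dens B n.
Proof.
move=> hB; elim: m X => [|m IH] X CX.
  rewrite mul0r addr0; apply: density_sumset_le => k _ /CX[]//.
have {}CX : C `<=` (X `|` [set m]) `|` [set k | (k < m)%N].
  move=> k /CX[Xk|/=]; first by left; left.
  by rewrite ltnS leq_eqVlt => /orP[/eqP ->|]; [left; right|right].
apply: le_trans (IH _ CX) _; rewrite -natr1 mulrDl mul1r [leRHS]addrA addrAC lerD2r.
exact: (@density_sumset_setU1 _ _ _ m).
Qed.

Lemma has_density_near S (d e : R) : has_density S d -> 0 < e ->
  exists N, forall n, (N <= n)%N -> d - e < dens S n < d + e.
Proof.
move=> [dl du] e0.
have [||N1 H1] := @lt_limn_inf R (dens S) (d - e) => //.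
  by rewrite -/(lower_density R S) dl ltrBlDr ltrDl.
have [||N2 H2] := @limn_sup_lt R (dens S) (d + e) => //.
  by rewrite -/(upper_density R S) du ltrDl.
by exists (maxn N1 N2) => n; rewrite geq_max => /andP[? ?]; rewrite H1// H2.
Qed.

(* If deleting [M + 1, ..., j] from [X] never violates the lower bound [alpha], take [j] huge:
   finitely many translates of [B] remain below [j]. Otherwise take the last [j] that
   respects the bound: the next deletion changes the density by at most that of [B]. *)
Lemma delete_block B X (alpha e : R) (n0 M : nat) :
  B `<=` pos_nat -> has_density B (0 : R) -> 0 <= alpha -> 0 < e ->
  (forall n, (n0 <= n)%N -> alpha <= dens (sumset X B) n) ->
  exists X' n m, [/\ X' `<=` X, forall k, (k <= M)%N -> X k -> X' k,
    X `<=` X' `|` [set k | (k < m)%N],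
    forall i, (n0 <= i)%N -> alpha <= dens (sumset X' B) i &
    (M <= n)%N /\ dens (sumset X' B) n <= alpha + e].
Proof.
move=> hB dB a0 e0 inv.
have [N BN] := has_density_near dB e0.
(* Deletion starts after [M1] rather than [M], so that every [n] beyond the block satisfies
   [N <= n], where the density of [B] is below [e]. *)
pose M1 := maxn M N.
pose Y j := X `&` [set k | (k <= M1)%N || (j < k)%N].
have YX j : Y j `<=` X by move=> k [].
have XY j k : (k <= M)%N -> X k -> Y j k.
  by move=> kM Xk; split => //=; apply/orP; left; rewrite /M1; lia.
have XYj j : X `<=` Y j `|` [set k | (k < j.+1)%N].
  move=> k Xk; case: (leqP k j) => kj; first by right.
  by left; split => //=; rewrite kj orbT.
pose P j := `[< forall n, (n0 <= n)%N -> alpha <= dens (sumset (Y j) B) n >].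
have [allP|] := pselect (forall j, P j).
  (* Up to [j], only the [M1.+1] numbers 0, ..., [M1] can survive in [Y j], and each contributes one
     translate of [B]. *)
  have e1 : 0 < e / M1.+1%:R by rewrite divr_gt0.
  have [N' BN'] := has_density_near dB e1.
  pose j := maxn N' M1.
  exists (Y j), j, j.+1; split => //; first exact: XY.
    exact/asboolP/allP.
  split; first by rewrite /j /M1; lia.
  have : dens (sumset (Y j) B) j <= dens (sumset set0 B) j + M1.+1%:R * dens B j.
    apply: (@le_trans _ _ (dens (sumset (Y j `&` [set k | (k <= M1)%N]) B) j)).
      apply: density_sumset_le => k kj [Xk /= h]; split; first by split.
      by move: h => /=; lia.
    apply: density_sumset_setU_initial => // k [_ /= kM]; right => /=; lia.
  have -> : dens (sumset set0 B) j = 0.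
    rewrite /density_seq /counting_fun (@eq_count _ _ pred0) ?count_pred0 ?mul0r//.
    by move=> k /=; apply/negbTE/negP => /set_mem[].
  have /BN'/andP[_] : (N' <= j)%N by rewrite leq_maxl.
  rewrite !add0r ltr_pdivlMr// mulrC => h1 h2.
  by rewrite (le_trans h2)// (le_trans (ltW h1))// lerDr.
move=> /existsNP/cid[j0 Pj0].
have exP : exists j, ~~ P j by exists j0; apply/negP.
case: (ex_minnP exP) => j nPj jmin.
have P0 i : (i <= M1)%N -> P i.
  move=> iM; apply/asboolP => n /inv h; apply: le_trans h _.
  apply: density_sumset_le => k _ Xk; split => //=; lia.
have jM : (M1 < j)%N by rewrite ltnNge; apply/negP => /P0; exact/negP.
(* From here [j.+1] is the least failing index, so [Y j] still respects the bound. *)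
case: j => // j in nPj jmin jM *.
have Pj : P j by apply/negPn/negP => /jmin; rewrite ltnn.
move/asboolP in Pj.
move: nPj => /asboolP/existsNP[n /not_implyP[n0n /negP]]; rewrite -ltNge => nlt.
(* Up to [j] the sets [Y j] and [Y j.+1] coincide, so the bound can fail for [Y j.+1] only at some
   [n] beyond [j]. *)
have jn : (j < n)%N.
  rewrite ltnNge; apply/negP => nj.
  have := Pj _ n0n; rewrite leNgt => /negP; apply; apply: le_lt_trans nlt.
  by apply: density_sumset_le => k kn [Xk /= h]; split => //=; lia.
exists (Y j), n, j.+1; split => //; first exact: XY.
split; first by rewrite (leq_trans _ jn)// (leq_trans _ jM)// /M1; lia.
have h : Y j `<=` Y j.+1 `|` [set j.+1].
  move=> k [Xk /= h]; have [->|kj] := eqVneq k j.+1; first by right.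
  by left; split => //=; lia.
apply: le_trans (density_sumset_setU1 n hB h) _.
apply: lerD; first exact: ltW.
have /BN/andP[_] : (N <= n)%N by rewrite /M1 in jM; lia.
by rewrite add0r => /ltW.
Qed.

(** The loss is at most [m] times the density of [B] in [1, n], which tends to 0. This brings the
    density back near [beta] after finitely many deletions. *)
Lemma density_sumset_cofinite_ge B C X (d : R) m : B `<=` pos_nat ->
  has_density B (0 : R) -> has_density (sumset C B) d ->
  C `<=` X `|` [set k | (k < m)%N] ->
  forall (e : R) M, 0 < e -> exists2 n, (M <= n)%N & d - e <= dens (sumset X B) n.
Proof.
move=> hB dB dC CX e M e0.
(* Half of [e] pays for the [m] translates, half for the distance to [d]; [m.+1] avoids dividing by
   zero. *)
have e1 : 0 < e / 2 / m.+1%:R by rewrite !divr_gt0.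
have e2 : 0 < e / 2 by rewrite divr_gt0.
have [N1 H1] := has_density_near dB e1.
have [N2 H2] := has_density_near dC e2.
pose n := maxn M (maxn N1 N2); exists n; first by rewrite /n; lia.
have /H2/andP[h1 _] : (N2 <= n)%N by rewrite /n; lia.
have /H1/andP[_] : (N1 <= n)%N by rewrite /n; lia.
rewrite add0r ltr_pdivlMr// -natr1 => h2.
have h3 := density_sumset_setU_initial n hB CX.
have h4 := density_seq_ge0 B n.
lra.
Qed.

End density.

Unset Implicit Arguments.

Theorem theorem1p7 (R : realType) (B : set nat) (alpha beta : R)
  (hB : B `<=` pos_nat) (dB : has_density B (0 : R))
  (h0 : 0 <= alpha) (hab : alpha <= beta) (h1 : beta <= 1) :
  (exists C : set nat,
     C `<=` pos_nat /\ has_density (sumset C B) beta) ->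
  exists A : set nat,
    [/\ A `<=` pos_nat,
        lower_density R (sumset A B) = alpha &
        upper_density R (sumset A B) = beta].
Proof.
move=> [C [hC dC]].
move: hab; rewrite le_eqVlt => /predU1P[->|ab]; first by exists C; case: dC.
have [n0 inv0] : exists n0, forall n, (n0 <= n)%N ->
    alpha <= density_seq R (sumset C B) n.
  have [|n0 H] := has_density_near dC (e := beta - alpha); first by rewrite subr_gt0.
  by exists n0 => n /H/andP[+ _]; rewrite subKr => /ltW.
pose inv (X : set nat) := [/\ X `<=` C,
  exists m, C `<=` X `|` [set k | (k < m)%N] &
  forall n, (n0 <= n)%N -> alpha <= density_seq R (sumset X B) n].
(* A state is a set with a bound up to which it is frozen. Both witnesses lie below the new bound,
   so later steps do not disturb their densities. *)
pose step (s t : {X | inv X} * nat) :=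
  [/\ sval t.1 `<=` sval s.1,
      forall k, (k <= s.2)%N -> sval s.1 k -> sval t.1 k,
      (s.2 < t.2)%N,
      exists2 n, (s.2 <= n <= t.2)%N &
        density_seq R (sumset (sval t.1) B) n <= alpha + s.2.+1%:R^-1 &
      exists2 n, (s.2 <= n <= t.2)%N &
        beta - s.2.+1%:R^-1 <= density_seq R (sumset (sval t.1) B) n].
have stepP s : {t | step s t}.
  apply: cid; case: s => [[X [XC [m CX] invX]] M].
  have e0 : (0 : R) < M.+1%:R^-1 by rewrite invr_gt0.
  have [X' [n [m' [X'X XX' XX'm invX' [Mn le_n]]]]] :=
    delete_block M hB dB h0 e0 invX.
  have CX' : C `<=` X' `|` [set k | (k < maxn m m')%N].
    move=> k /CX[/XX'm[Xk|/= km]|/= km]; first by left.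
      by right => /=; lia.
    by right => /=; lia.
  (* The same [X'] serves for the value near [alpha] and the value near [beta], since it misses only
     finitely many elements of [C]. *)
  have [n' Mn' ge_n'] := density_sumset_cofinite_ge hB dB dC CX' M e0.
  have iX' : inv X'.
    split => //; first exact: subset_trans XC.
    by exists (maxn m m').
  exists (exist _ X' iX', (maxn n n').+1); split => //=.
  - by lia.
  - by exists n => //; lia.
  - by exists n' => //; lia.
have invC : inv C by split => //; exists 0%N => k; left.
have [f [_ fS]] := dependent_choice stepP (exist _ C invC, 0%N).
pose X k := sval (f k).1.
pose M k := (f k).2.
have Mlt k : (M k < M k.+1)%N by case: (fS k).
(* Hence stage [n] already determines the limit set on [1, n]. *)
have Mk k : (k <= M k)%N by elim: k => // k IH; exact: leq_ltn_trans (Mlt k).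
have Mmono : {homo M : i j / (i <= j)%N}.
  by apply: homo_leq => // [? ? ?|k]; [exact: leq_trans|exact: ltnW].
pose A := \bigcap_k X k.
(* The sets [X k] decrease and from stage [k] on nothing up to [M k] is removed, so [A] and [X k]
   agree up to [M k]. *)
have AX k : A `<=` X k by move=> i; exact.
have XA k i : (i <= M k)%N -> X k i -> A i.
  move=> iM Xi l _.
  have [kl|/ltnW lk] := leqP k l.
    rewrite -(subnKC kl); elim: (l - k)%N => [|d IH]; first by rewrite addn0.
    rewrite addnS; case: (fS (k + d)%N) => _ + _ _ _; apply => //.
    by apply: leq_trans iM _; apply: Mmono; rewrite leq_addr.
  move: Xi; rewrite -(subnKC lk); elim: (k - l)%N => [|d IH]; first by rewrite addn0.
  by rewrite addnS => Xi; apply: IH; case: (fS (l + d)%N) => + _ _ _ _; exact.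
have AE k n : (n <= M k)%N ->
    density_seq R (sumset A B) n = density_seq R (sumset (X k) B) n.
  move=> nM; apply/le_anti/andP; split; apply: density_sumset_le => i iN.
    exact: AX.
  by apply: XA; exact: leq_trans nM.
have AC : A `<=` C by move=> i /(AX 0%N); case: (svalP (f 0%N).1) => + _ _; exact.
have bA := @density_seq_bounded R (sumset A B).
have small (e : R) N : 0 < e -> exists2 k, (N <= M k)%N & (M k).+1%:R^-1 <= e.
  move=> /ltr_add_invr[k]; rewrite add0r => ke.
  exists (maxn N k); first exact: leq_trans (leq_maxl _ _) (Mk _).
  apply: le_trans (ltW ke); rewrite lef_pV2 ?posrE// ler_nat ltnS.
  exact: leq_trans (leq_maxr _ _) (Mk _).
exists A; split; first exact: subset_trans hC.
- apply/le_anti/andP; split; last first.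
    apply: (@limn_inf_ge _ _ _ n0) => // n n0n.
    by rewrite (AE n)//; case: (svalP (f n).1) => _ _; exact.
  apply/ler_addgt0Pr => e e0; apply: limn_inf_le => // N.
  have [k Nk ke] := small e N e0.
  case: (fS k) => _ _ _ [n /andP[kn nk] le_n] _.
  exists n; first exact: leq_trans kn.
  by rewrite (AE k.+1)// (le_trans le_n)// lerD2l.
- apply/le_anti/andP; split.
    apply/ler_addgt0Pr => e e0; have [N HN] := has_density_near dC e0.
    apply: (@limn_sup_le _ _ _ N) => // n /HN/andP[_ /ltW]; apply: le_trans.
    by apply: density_sumset_le => i _; exact: AC.
  apply/ler_addgt0Pl => e e0; rewrite -lerBlDl; apply: limn_sup_ge => // N.
  have [k Nk ke] := small e N e0.
  case: (fS k) => _ _ _ _ [n /andP[kn nk] le_n].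
  exists n; first exact: leq_trans kn.
  by rewrite (AE k.+1)// (le_trans _ le_n)// lerD2l lerN2.
Qed.
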